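(* Let $a,b\in\mathbb{R}$, $\beta\in\mathbb{C}$, and let $k$ be a positive integer. Then $$\Im_{\beta,q}(-n;x,a,b)=-\frac{(n-k)!}{n!}S_{n,\beta,q}(x|k,a,b).$$
   Context: Here $q$ is a fixed real number with $|q|<1$, and $[x]_q=\frac{1-q^x}{1-q}$. The unification of $q$-extension of Genocchi polynomials $S_{n,\beta,q}(x|k,a,b)$ is defined by the generating function $$\sum_{n=0}^{\infty}S_{n,\beta,q}(x|k,a,b)\frac{t^n}{n!}=-[2]_q^{1-k}t^k\sum_{m=0}^{\infty}\beta^{bm}a^{-bm-b}e^{[m+x]_q t}.$$ The $q$-extension of the Hurwitz-zeta type function is $$\Im_{\beta,q}(s;x,a,b)=[2]_q^{1-k}\sum_{m=0}^{\infty}\frac{\beta^{bm}a^{-bm-b}}{[m+x]_q^{s}},\qquad s\in\mathbb{C}$$ (the dependence on $k$ is suppressed in the notation).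
   Formalization: The printed identity is false (k=n=b=β=x=1, a=2, q=1/2 gives 4/3 on the left, 1 on the right); the zeta function's argument -n is corrected to -(n-k), for n ≥ k, with the right-hand side unchanged. *)

(* Defs.v *)
From Stdlib Require Import Reals Factorial.
From Coquelicot Require Import Coquelicot.

Local Open Scope C_scope.

Definition Cexp (z : C) : C :=
  RtoC (exp (Re z)) * (cos (Im z), sin (Im z)).

(* Principal argument, with values in (-PI, PI]; only meaningful for z <> 0. *)
Definition Carg (z : C) : R :=
  if Rle_dec 0 (Im z) then acos (Re z / Cmod z) else (- acos (Re z / Cmod z))%R.

Definition Clog (z : C) : C := (ln (Cmod z), Carg z).

(* Principal branch, extended by 0 ^ 0 = 1 and 0 ^ w = 0 for w <> 0.  Since
   / 0 = 0 in C, one has / Cpower z (- n) = z ^ n for every z and natural n. *)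
Definition Cpower (z w : C) : C :=
  if Ceq_dec z 0
  then (if Ceq_dec w 0 then 1 else 0)
  else Cexp (w * Clog z).

(* [x]_q.  The base q is real but may be negative, so q ^ x is complex. *)
Definition qnum (q : R) (x : C) : C := (1 - Cpower q x) / (1 - q).

(* beta^(b m) a^(- b m - b) *)
Definition weight (beta : C) (a b : R) (m : nat) : C :=
  Cpower beta (RtoC (b * INR m)) * Cpower a (RtoC (- (b * INR m) - b)).

(* [2]_q^(1 - k) *)
Definition qtwo_factor (q : R) (k : nat) : C :=
  Cpower (qnum q 2) (RtoC (1 - INR k)).

(* S is the sequence of values at x of the unified q-extension of the Genocchi
   polynomials: for all t near 0 the series G = sum_m weight m * e^([m+x]_q t)
   converges, and sum_n S n * t^n / n! converges to - [2]_q^(1-k) * t^k * G.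
   This condition determines S. *)
Definition is_unified_qGenocchi (q : R) (beta : C) (a b : R) (k : nat) (x : C)
    (S : nat -> C) : Prop :=
  locally (0 : C) (fun t : C => exists G : C,
    is_series (fun m : nat =>
      weight beta a b m * Cexp (qnum q (RtoC (INR m) + x) * t)) G /\
    is_series (fun n : nat => S n * (t ^ n / RtoC (INR (fact n))))
      (- (qtwo_factor q k * t ^ k * G))).

(* Sum of a complex series; only meaningful for convergent series. *)
Definition CSeries (u : nat -> C) : C :=
  (Series (fun m => Re (u m)), Series (fun m => Im (u m))).

Definition qHurwitz_term (q : R) (beta : C) (a b : R) (s x : C) (m : nat) : C :=
  weight beta a b m / Cpower (qnum q (RtoC (INR m) + x)) s.

Definition qHurwitz_zeta (q : R) (beta : C) (a b : R) (k : nat) (s x : C) : C :=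
  qtwo_factor q k * CSeries (qHurwitz_term q beta a b s x).

(* Main.v *)
(* Both weight factors are powers of principal branches, so weight m is a
   geometric sequence; convergence of the generating series at t = 0 makes it
   absolutely summable, while [m+x]_q stays bounded because |q| < 1.  With
   A_j := sum_m weight m * [m+x]_q^j, the Taylor estimate
   |e^z - P_N(z)| <= e^|z| |z|^(N+1), summed over m, gives
   G(t) = sum_(j <= N) A_j t^j / j! + O(t^(N+1)) as t tends to 0 along the
   positive reals.  Comparing the coefficients of t^n in this expansion and in
   the power series for - [2]_q^(1-k) t^k G(t) yields
   S n / n! = - [2]_q^(1-k) A_(n-k) / (n-k)!. *)
Require Import Defs.
From Stdlib Require Import Reals Factorial Lra Lia.
From Coquelicot Require Import Coquelicot.

Local Open Scope C_scope.

(** * Complex exponential, principal logarithm and powers *)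

Lemma Cexp_0 : Cexp 0 = 1.
Proof.
unfold Cexp; simpl; rewrite exp_0, cos_0, sin_0.
apply injective_projections; simpl; ring.
Qed.

Lemma Cexp_plus (z w : C) : Cexp (z + w) = Cexp z * Cexp w.
Proof.
destruct z as [x y], w as [x' y']; unfold Cexp; simpl.
rewrite exp_plus, cos_plus, sin_plus.
apply injective_projections; simpl; ring.
Qed.

Lemma Cexp_neq_0 (z : C) : Cexp z <> 0.
Proof.
intros H; apply C1_nz.
rewrite <- Cexp_0, <- (Cplus_opp_r z), Cexp_plus, H; ring.
Qed.

Lemma Cexp_opp (z : C) : Cexp (- z) = / Cexp z.
Proof.
assert (H := Cexp_neq_0 z).
replace (/ Cexp z) with (Cexp (- z + z) * / Cexp z).
- rewrite Cexp_plus; now field.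
- replace (- z + z) with (RtoC 0) by ring; rewrite Cexp_0; now field.
Qed.

Lemma Cexp_mult_INR (z : C) (n : nat) : Cexp (z * INR n) = Cexp z ^ n.
Proof.
induction n as [|n IH].
- now rewrite Cmult_0_r, Cexp_0.
- rewrite S_INR, Cpow_S, <- IH, <- Cexp_plus; f_equal.
  rewrite RtoC_plus; ring.
Qed.

Lemma Cmod_Cexp (z : C) : Cmod (Cexp z) = exp (Re z).
Proof.
unfold Cexp; rewrite Cmod_mult, Cmod_R, Rabs_pos_eq by apply Rlt_le, exp_pos.
unfold Cmod; simpl fst; simpl snd.
replace (cos (Im z) ^ 2 + sin (Im z) ^ 2)%R with 1%R.
- now rewrite sqrt_1, Rmult_1_r.
- generalize (sin2_cos2 (Im z)); unfold Rsqr; intros; lra.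
Qed.

(** [acos] fixes the cosine of the argument, hence its sine up to sign as |Im z| / |z|; the case
    split in [Carg] restores the sign of [Im z]. *)
Lemma Cexp_Clog (z : C) : z <> 0 -> Cexp (Clog z) = z.
Proof.
intros Hz; assert (Hm : (0 < Cmod z)%R) by now apply Cmod_gt_0.
assert (Hm2 : (Cmod z ^ 2 = Re z ^ 2 + Im z ^ 2)%R) by apply Cmod2_alt.
assert (Hu : (-1 <= Re z / Cmod z <= 1)%R).
{ assert (H := re_le_Cmod z); apply Rabs_le_between in H.
  split; [apply Rle_div_r | apply Rle_div_l]; lra. }
assert (Hc : cos (Carg z) = (Re z / Cmod z)%R).
{ unfold Carg; destruct Rle_dec; [|rewrite cos_neg]; now apply cos_acos. }
assert (Hs : sin (Carg z) = (Im z / Cmod z)%R).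
{ assert (Hv : sqrt (1 - Rsqr (Re z / Cmod z)) = (Rabs (Im z) / Cmod z)%R).
  { replace (1 - Rsqr (Re z / Cmod z))%R with (Rsqr (Im z / Cmod z)).
    - rewrite sqrt_Rsqr_abs, Rabs_div by lra.
      now rewrite (Rabs_pos_eq (Cmod z)) by lra.
    - unfold Rsqr; apply (Rmult_eq_reg_r (Cmod z ^ 2)); [|nra].
      field_simplify; lra. }
  unfold Carg; destruct Rle_dec.
  - rewrite sin_acos, Hv, Rabs_pos_eq by lra; easy.
  - rewrite sin_neg, sin_acos, Hv, Rabs_left by lra; field; lra. }
unfold Cexp, Clog; simpl Re; simpl Im; rewrite Hc, Hs, exp_ln by easy.
apply injective_projections; simpl; unfold Re, Im; field; lra.
Qed.

Lemma Cpower_neq_0 (z w : C) : z <> 0 -> Cpower z w = Cexp (w * Clog z).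
Proof. now intros H; unfold Cpower; destruct (Ceq_dec z 0). Qed.

(** A natural multiplier causes no branch problem, since the same logarithm occurs on both sides. At
    [z = 0] the conventions 0^0 = 1 and 0^w = 0 agree with natural powers. *)
Lemma Cpower_mult_INR (z w : C) (n : nat) :
  Cpower z (w * INR n) = Cpower z w ^ n.
Proof.
destruct (Ceq_dec z 0) as [Hz|Hz].
- unfold Cpower; destruct (Ceq_dec z 0); [|easy].
  destruct (Ceq_dec w 0) as [->|Hw].
  + rewrite Cmult_0_l, Cpow_1_l; now destruct (Ceq_dec 0 0).
  + destruct n as [|n].
    * rewrite Cmult_0_r; now destruct (Ceq_dec 0 0).
    * rewrite Cpow_S, Cmult_0_l.
      destruct (Ceq_dec (w * INR (S n)) 0) as [H|]; [|easy].
      destruct (Cmult_neq_0 w (INR (S n))); [easy| |easy].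
      intros E; apply RtoC_inj in E; now apply (not_0_INR (S n)) in E.
- rewrite !Cpower_neq_0, <- Cexp_mult_INR by easy; f_equal; ring.
Qed.

(** Turns the division in the zeta term at s = -j into a j-th power, also where [m+x]_q vanishes. *)
Lemma inv_Cpower_opp_INR (z : C) (j : nat) :
  / Cpower z (RtoC (- INR j)) = z ^ j.
Proof.
replace (RtoC (- INR j)) with (RtoC (-1) * INR j)
  by (rewrite <- RtoC_mult; f_equal; ring).
rewrite Cpower_mult_INR.
destruct (Ceq_dec z 0) as [->|Hz].
- unfold Cpower; destruct (Ceq_dec 0 0) as [_|]; [|easy].
  destruct (Ceq_dec (-1) 0) as [E|_]; [apply RtoC_inj in E; lra|].
  destruct j as [|j].
  + simpl; field; apply C1_nz.
  (* For a positive exponent both sides are 0, because / 0 = 0. *)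
  + rewrite Cpow_S, !Cmult_0_l.
    apply injective_projections; simpl; unfold Rdiv; ring.
- rewrite Cpower_neq_0 by easy.
  replace (RtoC (-1) * Clog z) with (- Clog z)
    by (replace (-1)%R with (- (1))%R by ring; rewrite RtoC_opp; ring).
  rewrite Cexp_opp, Cexp_Clog by easy.
  rewrite Cpow_inv by easy; field; now apply Cpow_nz.
Qed.

(** * Geometric weights and bounded q-numbers *)

Lemma weight_eq (beta : C) (a b : R) (m : nat) :
  weight beta a b m = Cpower beta b ^ m * Cpower a (RtoC (- b)) ^ S m.
Proof.
unfold weight; rewrite <- !Cpower_mult_INR; f_equal; f_equal;
  rewrite <- RtoC_mult; try easy; f_equal; rewrite S_INR; ring.
Qed.

(** If q is nonzero, then q^(m+x) = q^m q^x with |q|^m <= 1; if q = 0, the power is 0 or 1. The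
    bound 1 + |q^x| covers both cases. *)
Lemma Cmod_qnum_bounded (q : R) (x : C) : (Rabs q < 1)%R ->
  exists M : R, forall m : nat, (Cmod (qnum q (RtoC (INR m) + x)) <= M)%R.
Proof.
intros hq; apply Rabs_def2 in hq as hq'.
exists ((2 + Cmod (Cpower q x)) / (1 - q))%R; intros m.
assert (H : (Cmod (Cpower q (RtoC (INR m) + x)) <= 1 + Cmod (Cpower q x))%R).
{ assert (H0 := Cmod_ge_0 (Cpower q x)).
  destruct (Ceq_dec q 0) as [Hq|Hq].
  - unfold Cpower at 1; destruct (Ceq_dec q 0); [|easy].
    destruct Ceq_dec; rewrite ?Cmod_1, ?Cmod_0; lra.
  - rewrite !Cpower_neq_0, Cmult_plus_distr_r, Cexp_plus, Cmod_mult by easy.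
    rewrite (Cmult_comm (INR m)), Cexp_mult_INR, Cexp_Clog, Cmod_pow, Cmod_R by easy.
    rewrite Cpower_neq_0 in H0 by easy.
    assert (H1 : (Rabs q ^ m <= 1)%R).
    { rewrite <- (pow1 m); apply pow_incr; split; [apply Rabs_pos | lra]. }
    nra. }
unfold qnum; replace (1 - q)%C with (RtoC (1 - q)) by apply RtoC_minus.
rewrite Cmod_div by (intros E; apply RtoC_inj in E; lra).
rewrite Cmod_R, (Rabs_pos_eq (1 - q)) by lra.
apply Rmult_le_compat_r; [apply Rlt_le, Rinv_0_lt_compat; lra|].
eapply Rle_trans; [apply Cmod_triangle|].
rewrite Cmod_opp, Cmod_1; lra.
Qed.

(** * Taylor estimate for the complex exponential *)

Definition exp_poly (N : nat) (z : C) : C :=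
  sum_n (fun j => z ^ j / RtoC (INR (fact j))) N.

Lemma exp_poly_O (z : C) : exp_poly 0 z = 1.
Proof. unfold exp_poly; rewrite sum_O; simpl; field; apply C1_nz. Qed.

Lemma exp_poly_S (N : nat) (z : C) :
  exp_poly (S N) z = exp_poly N z + z ^ S N / RtoC (INR (fact (S N))).
Proof. apply (sum_Sn (G := C_AbelianMonoid)). Qed.

(* The mean value theorem fails for complex values; testing against
   [u = Cconj (f 1 - f 0)] reduces to the real one. *)
Lemma Cmod_increment_le (f f' : R -> C) (B : R) :
  (forall (u : C) (s : R), is_derive (fun s : R => Re (u * f s)) s (Re (u * f' s))) ->
  (forall s : R, (0 <= s <= 1)%R -> (Cmod (f' s) <= B)%R) ->
  (Cmod (f 1%R - f 0%R) <= B)%R.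
Proof.
intros Hd HB; set (d := f 1%R - f 0%R); set (u := Cconj d).
destruct (MVT_gen (fun s => Re (u * f s)) 0 1 (fun s => Re (u * f' s)))
  as [c [Hc E]].
- intros s _; apply Hd.
- intros s _; apply continuity_pt_filterlim, (ex_derive_continuous (fun s => Re (u * f s))).
  eexists; apply Hd.
- rewrite Rmin_left, Rmax_right in Hc by lra.
  assert (H1 : (Cmod d ^ 2 = Re (u * f' c))%R).
  { rewrite Rminus_0_r, Rmult_1_r in E; rewrite <- E.
    rewrite Cmod2_alt; unfold u, d; simpl; unfold Re, Im; simpl; ring. }
  assert (H2 := re_le_Cmod (u * f' c)); rewrite Cmod_mult in H2.
  unfold u in H2 at 2; rewrite Cmod_conj in H2.
  assert (H3 := Rle_abs (Re (u * f' c))); assert (H4 := HB c Hc).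
  assert (H5 := Cmod_ge_0 d); assert (H6 := Cmod_ge_0 (f' c)).
  destruct (Rle_or_lt (Cmod d) B) as [|Hlt]; [easy|].
  nra.
Qed.

(** The real part against an arbitrary [u] is the form of derivative that [Cmod_increment_le]
    takes. *)
Lemma is_derive_Cexp (u z : C) (s : R) :
  is_derive (fun s : R => Re (u * Cexp (s * z))) s (Re (u * (z * Cexp (s * z)))).
Proof.
destruct u as [p r], z as [x y]; unfold Cexp; simpl.
auto_derive; [easy|]. unfold Rminus; ring.
Qed.

(** Differentiation lowers the degree by one, which drives the induction in [Cexp_taylor]. *)
Lemma is_derive_exp_poly (u z : C) (N : nat) (s : R) :
  is_derive (fun s : R => Re (u * exp_poly (S N) (s * z))) s
    (Re (u * (z * exp_poly N (s * z)))).
Proof.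
assert (Hterm : forall j, is_derive
  (fun s : R => Re (u * ((s * z) ^ S j / RtoC (INR (fact (S j)))))) s
  (Re (u * (z * ((s * z) ^ j / RtoC (INR (fact j))))))).
{ intros j; assert (Hj := INR_fact_neq_0 j).
  assert (HSj := INR_fact_neq_0 (S j)).
  assert (Hn : INR (S j) <> 0%R) by now apply not_0_INR.
  (* The parameter is real, so its power leaves the real part and each term is a real monomial times
     a constant. *)
  assert (E : forall s' : R, Re (u * ((s' * z) ^ S j / RtoC (INR (fact (S j)))))
     = (s' ^ S j * (Re (u * z ^ S j) / INR (fact (S j))))%R).
  { intros s'; rewrite Cpow_mult_l, <- RtoC_pow; unfold Cdiv, Rdiv.
    rewrite <- RtoC_inv by easy.
    generalize (s' ^ S j)%R (z ^ S j) (/ INR (fact (S j)))%R; intros.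
    simpl; ring. }
  eapply is_derive_ext; [intros s'; symmetry; apply E|].
  replace (Re (u * (z * ((s * z) ^ j / RtoC (INR (fact j))))))
    with (INR (S j) * s ^ j * (Re (u * z ^ S j) / INR (fact (S j))))%R.
  - generalize (Re (u * z ^ S j) / INR (fact (S j)))%R; intros c.
    rewrite (Rmult_comm _ c).
    eapply is_derive_ext; [intros s'; apply Rmult_comm|].
    apply (is_derive_scal (fun s' => s' ^ S j)%R s c).
    replace (INR (S j) * s ^ j)%R with (INR (S j) * 1 * s ^ pred (S j))%R
      by (simpl pred; ring).
    apply (is_derive_pow (fun s' => s') (S j) s 1), (is_derive_id (K := R_AbsRing)).
  - rewrite Cpow_mult_l, <- RtoC_pow; unfold Cdiv.
    rewrite <- RtoC_inv by easy.
    rewrite fact_simpl, mult_INR, Cpow_S.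
    generalize (s ^ j)%R (z ^ j); intros.
    simpl Re; field; easy. }
induction N as [|N IH].
- eapply is_derive_ext.
  + intros s'; symmetry; rewrite exp_poly_S, exp_poly_O.
    replace (Re (u * _)) with
      (Re u + Re (u * ((s' * z) ^ 1 / RtoC (INR (fact 1)))))%R; [reflexivity|].
    generalize ((s' * z) ^ 1 / RtoC (INR (fact 1))); intros v.
    unfold Re; simpl; ring.
  + rewrite exp_poly_O.
    (* The 0 is the derivative of the constant term [Re u]. *)
    replace (Re (u * (z * 1))) with (0 + Re (u * (z * ((s * z) ^ 0 / RtoC (INR (fact 0))))))%R.
    2: { rewrite Rplus_0_l; rewrite <- (exp_poly_O (s * z)); unfold exp_poly; now rewrite sum_O. }
    apply (is_derive_plus (fun _ => Re u)); [apply @is_derive_const|apply Hterm].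
- eapply is_derive_ext.
  + intros s'; symmetry; rewrite exp_poly_S, Cmult_plus_distr_l; reflexivity.
  + rewrite (exp_poly_S N), !Cmult_plus_distr_l.
    apply (is_derive_plus (fun s : R => Re (u * exp_poly (S N) (s * z)))).
    * apply IH.
    * apply Hterm.
Qed.

(** Induction on N along the segment from 0 to z: the derivative of the remainder of degree N+1 is z
    times the remainder of degree N, so each step gains a factor |z|. *)
Lemma Cexp_taylor (N : nat) (z : C) :
  (Cmod (Cexp z - exp_poly N z) <= exp (Cmod z) * Cmod z ^ S N)%R.
Proof.
assert (Hexp : forall s w, (0 <= s <= 1)%R -> (exp (Re (RtoC s * w)) <= exp (Cmod w))%R).
{ intros s w Hs; replace (Re (RtoC s * w)) with (s * Re w)%R
    by (unfold Re; simpl; ring).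
  assert (H := re_le_Cmod w); assert (H' := Rle_abs (Re w)).
  assert (H0 := Cmod_ge_0 w).
  (* [exp_increasing] is strict, so equality is treated apart. *)
  destruct (Req_dec (s * Re w) (Cmod w)) as [->|Hne]; [lra|].
  apply Rlt_le, exp_increasing; nra. }
revert z; induction N as [|N IH]; intros z.
- assert (H : (Cmod (Cexp (RtoC 1 * z) - Cexp (RtoC 0 * z))
      <= exp (Cmod z) * Cmod z ^ 1)%R).
  { apply (Cmod_increment_le (fun s => Cexp (RtoC s * z))
      (fun s => z * Cexp (RtoC s * z))).
    - intros; apply is_derive_Cexp.
    - intros s Hs; rewrite Cmod_mult, Cmod_Cexp.
      rewrite pow_1, Rmult_comm.
      now apply Rmult_le_compat_r; [apply Cmod_ge_0|apply Hexp]. }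
  rewrite Cmult_1_l, Cmult_0_l, Cexp_0 in H.
  now rewrite exp_poly_O.
- assert (H : (Cmod ((Cexp (RtoC 1 * z) - exp_poly (S N) (RtoC 1 * z))
      - (Cexp (RtoC 0 * z) - exp_poly (S N) (RtoC 0 * z)))
      <= exp (Cmod z) * Cmod z ^ S (S N))%R).
  { apply (Cmod_increment_le (fun s => Cexp (RtoC s * z) - exp_poly (S N) (RtoC s * z))
      (fun s => z * (Cexp (RtoC s * z) - exp_poly N (RtoC s * z)))).
    - intros u s.
      apply (is_derive_ext (fun s : R => minus (Re (u * Cexp (s * z)))
        (Re (u * exp_poly (S N) (s * z))))).
      + intros t; generalize (Cexp (t * z)) (exp_poly (S N) (t * z)); intros.
        change minus with Rminus; simpl; ring.
      + replace (Re _) with (minus (Re (u * (z * Cexp (s * z))))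
          (Re (u * (z * exp_poly N (s * z))))).
        * apply @is_derive_minus; [apply is_derive_Cexp|apply is_derive_exp_poly].
        * generalize (Cexp (s * z)) (exp_poly N (s * z)); intros.
          change minus with Rminus; simpl; ring.
    - intros s Hs; rewrite Cmod_mult.
      assert (H0 := Cmod_ge_0 z).
      assert (Hsz : (Cmod (RtoC s * z) <= Cmod z)%R).
      { rewrite Cmod_mult, Cmod_R, Rabs_pos_eq by lra; nra. }
      replace (exp (Cmod z) * Cmod z ^ S (S N))%R
        with (Cmod z * (exp (Cmod z) * Cmod z ^ S N))%R by (simpl; ring).
      apply Rmult_le_compat_l; [easy|].
      eapply Rle_trans; [apply IH|].
      apply Rmult_le_compat; try apply Rlt_le, exp_pos.
      + apply pow_le, Cmod_ge_0.
      + destruct (Req_dec (Cmod (RtoC s * z)) (Cmod z)) as [->|Hne]; [lra|].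
        apply Rlt_le, exp_increasing; lra.
      + apply pow_incr; split; [apply Cmod_ge_0|easy]. }
  (* The remainder vanishes at 0, so the increment is the remainder at z. *)
  assert (H0 : forall M, exp_poly M 0 = 1).
  { induction M as [|M IHM].
    - apply exp_poly_O.
    - rewrite exp_poly_S, IHM, Cpow_S; unfold Cdiv; ring. }
  rewrite Cmult_1_l, Cmult_0_l, Cexp_0, H0 in H.
  replace (Cexp z - exp_poly (S N) z)
    with (Cexp z - exp_poly (S N) z - (1 - 1)) by ring; easy.
Qed.

(** * Convergent complex series *)

Lemma is_series_Re (u : nat -> C) (L : C) :
  is_series u L -> is_series (fun m => Re (u m)) (Re L).
Proof.
intros H.
apply (filterlim_ext (fun N => Re (sum_n u N))).
- intros N; induction N as [|N IH]; [rewrite !sum_O; reflexivity|].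
  rewrite !sum_Sn, <- IH; reflexivity.
- apply (filterlim_comp _ _ _ _ _ _ _ _ H).
  destruct L as [p r]; apply (continuous_fst (U := R_UniformSpace) (V := R_UniformSpace)).
Qed.

Lemma is_series_Im (u : nat -> C) (L : C) :
  is_series u L -> is_series (fun m => Im (u m)) (Im L).
Proof.
intros H.
apply (filterlim_ext (fun N => Im (sum_n u N))).
- intros N; induction N as [|N IH]; [rewrite !sum_O; reflexivity|].
  rewrite !sum_Sn, <- IH; reflexivity.
- apply (filterlim_comp _ _ _ _ _ _ _ _ H).
  destruct L as [p r]; apply (continuous_snd (U := R_UniformSpace) (V := R_UniformSpace)).
Qed.

Lemma CSeries_unique (u : nat -> C) (L : C) : is_series u L -> CSeries u = L.
Proof.
intros H; unfold CSeries.
rewrite (is_series_unique _ _ (is_series_Re u L H)).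
rewrite (is_series_unique _ _ (is_series_Im u L H)).
symmetry; apply surjective_pairing.
Qed.

(** |u| <= |Re u| + |Im u|, and both parts are terms of convergent real series. *)
Lemma Cmod_lim_0_of_ex_series (u : nat -> C) :
  ex_series u -> is_lim_seq (fun m => Cmod (u m)) 0.
Proof.
intros [L H].
assert (HR : ex_series (fun m => Re (u m))) by exact (ex_intro _ _ (is_series_Re _ _ H)).
assert (HI : ex_series (fun m => Im (u m))) by exact (ex_intro _ _ (is_series_Im _ _ H)).
apply ex_series_lim_0, is_lim_seq_abs in HR, HI.
apply (is_lim_seq_le_le (fun _ => 0%R) _ (fun m => Rabs (Re (u m)) + Rabs (Im (u m)))%R).
- intros m; split; [apply Cmod_ge_0|].
  replace (Cmod (u m)) with (Cmod (Re (u m) + Ci * Im (u m))).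
  + eapply Rle_trans; [apply Cmod_triangle|].
    rewrite Cmod_mult, Cmod_Ci, !Cmod_R; lra.
  + f_equal; apply injective_projections; simpl; unfold Re, Im; ring.
- apply is_lim_seq_const.
- assert (H0 := is_lim_seq_plus' _ _ _ _ HR HI).
  simpl in H0; rewrite Rabs_R0, Rplus_0_r in H0; exact H0.
Qed.

(** The triangle inequality for partial sums passes to the limit by continuity of the modulus. *)
Lemma Cmod_series_le (u : nat -> C) (v : nat -> R) (L : C) (V : R) :
  (forall m, (Cmod (u m) <= v m)%R) -> is_series u L -> is_series v V ->
  (Cmod L <= V)%R.
Proof.
intros Huv Hu Hv.
apply (is_lim_seq_le (fun N => Cmod (sum_n u N)) (sum_n v) (Cmod L) V).
- intros N; induction N as [|N IH]; [rewrite !sum_O; apply Huv|].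
  rewrite !sum_Sn.
  eapply Rle_trans; [apply Cmod_triangle|].
  now apply Rplus_le_compat.
- apply (filterlim_comp _ _ _ _ _ _ _ _ Hu).
  apply (filterlim_norm (K := C_AbsRing) (V := C_NormedModule)).
- exact Hv.
Qed.

Lemma is_series_sum_n (f : nat -> nat -> C) (L : nat -> C) (N : nat) :
  (forall j, is_series (fun m => f m j) (L j)) ->
  is_series (fun m => sum_n (f m) N) (sum_n L N).
Proof.
intros H; induction N as [|N IH].
- rewrite sum_O; eapply is_series_ext; [|apply H].
  intros m; rewrite sum_O; reflexivity.
- rewrite sum_Sn; eapply is_series_ext; [|apply (is_series_plus (K := C_AbsRing) (V := C_NormedModule) _ _ _ _ IH (H (S N)))].
  intros m; rewrite sum_Sn; reflexivity.
Qed.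

(** * Expansions at 0 of the exponential series and of a power series *)

(** The estimate of [Cexp_taylor] at [y m * t], where |y m t| <= M t <= M, is summed against |w m|.
    The constant K depends neither on t nor on G. *)
Lemma exp_series_taylor (w y : nat -> C) (A : nat -> C) (M : R) (N : nat) :
  (forall m, (Cmod (y m) <= M)%R) ->
  ex_series (fun m => Cmod (w m)) ->
  (forall j, is_series (fun m => w m * y m ^ j) (A j)) ->
  exists K : R, forall (t : R) (G : C), (0 < t <= 1)%R ->
    is_series (fun m => w m * Cexp (y m * t)) G ->
    (Cmod (G - sum_n (fun j => A j * (t ^ j / RtoC (INR (fact j))))%C N)
      <= K * t ^ S N)%R.
Proof.
intros HM [W HW] HA; exists (W * (exp M * M ^ S N))%R; intros t G Ht HG.
(* The finite sum over j is exchanged with the series over m. *)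
assert (HP : is_series (fun m => w m * exp_poly N (y m * t))
  (sum_n (fun j => A j * (t ^ j / RtoC (INR (fact j)))) N)).
{ eapply is_series_ext; [|apply (is_series_sum_n
    (fun m j => (t ^ j / RtoC (INR (fact j))) * (w m * y m ^ j)))].
  - intros m; unfold exp_poly.
    rewrite <- (sum_n_mult_l (K := C_Ring)); apply sum_n_ext; intros j.
    change (t ^ j / RtoC (INR (fact j)) * (w m * y m ^ j) =
      w m * ((y m * t) ^ j / RtoC (INR (fact j)))).
    rewrite Cpow_mult_l; unfold Cdiv; ring.
  - intros j; rewrite Cmult_comm.
    apply (is_series_scal (K := C_AbsRing) (V := C_NormedModule)), HA. }
replace (W * (exp M * M ^ S N) * t ^ S N)%R
  with (W * (exp M * M ^ S N * t ^ S N))%R by ring.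
eapply Cmod_series_le.
2: apply (is_series_minus (K := C_AbsRing) (V := C_NormedModule) _ _ _ _ HG HP).
2: apply (is_series_scal_r _ _ _ HW).
intros m; change plus with Cplus; change opp with Copp; cbv beta.
replace (w m * Cexp (y m * t) + - (w m * exp_poly N (y m * t)))
  with (w m * (Cexp (y m * t) - exp_poly N (y m * t))) by ring.
rewrite Cmod_mult; apply Rmult_le_compat_l; [apply Cmod_ge_0|].
eapply Rle_trans; [apply Cexp_taylor|].
assert (Hy : (Cmod (y m * t) <= M * t)%R).
{ rewrite Cmod_mult, Cmod_R, Rabs_pos_eq by lra.
  now apply Rmult_le_compat_r; [lra|]. }
assert (H0 := Cmod_ge_0 (y m * t)).
rewrite Rmult_assoc, <- Rpow_mult_distr.
apply Rmult_le_compat; [apply Rlt_le, exp_pos|now apply pow_le| |now apply pow_incr].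
assert (HM0 := Rle_trans _ _ _ (Cmod_ge_0 _) (HM m)).
destruct (Req_dec (Cmod (y m * t)) M) as [->|Hne]; [lra|].
apply Rlt_le, exp_increasing; nra.
Qed.

(** Convergence at t0 bounds |c n| t0^n by some B; for t <= t0/2 the terms past N are then dominated
    by a geometric series of ratio 1/2. *)
Lemma power_series_taylor (c : nat -> C) (t0 : R) (N : nat) :
  (0 < t0)%R -> ex_series (fun n => c n * RtoC t0 ^ n) ->
  exists K : R, forall (t : R) (F : C), (0 < t <= t0 / 2)%R ->
    is_series (fun n => c n * RtoC t ^ n) F ->
    (Cmod (F - sum_n (fun n => c n * RtoC t ^ n)%C N) <= K * t ^ S N)%R.
Proof.
intros Ht0 H; apply Cmod_lim_0_of_ex_series in H.
destruct (filterlim_bounded (K := R_AbsRing) (V := R_NormedModule) (fun m => Cmod (c m * RtoC t0 ^ m)))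
  as [B HB]; [now exists 0%R|].
assert (HB' : forall m, (Cmod (c m) * t0 ^ m <= B)%R).
{ intros m; rewrite <- (Rabs_pos_eq t0) by lra.
  rewrite <- Cmod_R, <- Cmod_pow, <- Cmod_mult.
  eapply Rle_trans; [apply Rle_abs|apply (HB m)]. }
assert (HB0 : (0 <= B)%R).
{ eapply Rle_trans; [|apply (HB' 0%nat)]; simpl; rewrite Rmult_1_r; apply Cmod_ge_0. }
(* [B / t0 ^ S N] bounds the first omitted coefficient; [/ (1 - / 2)] is the sum of the geometric
   series. *)
exists (B / t0 ^ S N * / (1 - / 2))%R; intros t F Ht HF.
assert (HT : is_series (fun n => c (S N + n)%nat * RtoC t ^ (S N + n))
  (F - sum_n (fun n => c n * RtoC t ^ n) N)).
{ apply (is_series_incr_n (K := C_AbsRing) (V := C_NormedModule)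
    (fun n => c n * RtoC t ^ n) (S N)); [lia|].
  set (P := sum_n (fun n => c n * RtoC t ^ n) N).
  change (is_series (fun n => c n * RtoC t ^ n) (F - P + P)).
  now replace (F - P + P) with F by ring. }
replace (B / t0 ^ S N * / (1 - / 2) * t ^ S N)%R
  with (B / t0 ^ S N * t ^ S N * / (1 - / 2))%R by ring.
eapply Cmod_series_le; [|apply HT|].
2: apply (is_series_scal (K := R_AbsRing) (V := R_NormedModule)), is_series_geom; rewrite Rabs_pos_eq; lra.
intros n; cbv beta; rewrite Cmod_mult, Cmod_pow, Cmod_R, Rabs_pos_eq by lra.
change scal with Rmult; cbv beta.
assert (Htp : forall p, (0 < t0 ^ p)%R) by (intros; now apply pow_lt).
assert (Hsp : forall p, (0 < t ^ p)%R) by (intros; now apply pow_lt).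
apply Rle_trans with (B / t0 ^ (S N + n) * t ^ (S N + n))%R.
- apply Rmult_le_compat_r; [now apply Rlt_le|].
  apply Rle_div_r; [apply Htp|apply HB'].
(* In (t/t0)^(N+1+n), the first N+1 factors give the order in t and the others are at most
   (1/2)^n. *)
- rewrite !pow_add.
  replace (B / (t0 ^ S N * t0 ^ n) * (t ^ S N * t ^ n))%R
    with (B / t0 ^ S N * t ^ S N * (t / t0) ^ n)%R.
  2: { unfold Rdiv at 2; rewrite Rpow_mult_distr, pow_inv.
       field; split; apply Rgt_not_eq, Htp. }
  apply Rmult_le_compat_l.
  + apply Rmult_le_pos; [apply Rdiv_le_0_compat|apply Rlt_le]; easy.
  + apply pow_incr; split; [apply Rdiv_le_0_compat; lra|].
    apply Rle_div_l; lra.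
Qed.

(** * Comparison of coefficients *)

Lemma eq_0_of_Cmod_le_linear (z : C) (K d : R) : (0 < d)%R ->
  (forall t : R, (0 < t < d)%R -> (Cmod z <= K * t)%R) -> z = 0.
Proof.
intros Hd H; apply Cmod_eq_0; assert (H0 := Cmod_ge_0 z).
destruct (Req_dec (Cmod z) 0) as [|Hne]; [easy|exfalso].
assert (HK : (0 < K)%R).
{ assert (H1 := H (d / 2)%R); nra. }
assert (Hm : (0 < Cmod z / (2 * K))%R) by (apply Rdiv_lt_0_compat; lra).
(* This t is admissible and makes K t at most |z|/2, a contradiction. *)
assert (Hmin : (0 < Rmin (d / 2) (Cmod z / (2 * K)) < d)%R).
{ split; [apply Rmin_glb_lt; lra|].
  eapply Rle_lt_trans; [apply Rmin_l|lra]. }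
assert (H1 := H _ Hmin).
assert (H2 := Rmin_r (d / 2) (Cmod z / (2 * K))).
apply (Rmult_le_compat_l K) in H2; [|lra].
replace (K * (Cmod z / (2 * K)))%R with (Cmod z / 2)%R in H2 by (field; lra).
lra.
Qed.

Lemma sum_n_shift (f : nat -> C) (N : nat) :
  sum_n f (S N) = f 0%nat + sum_n (fun i => f (S i)) N.
Proof.
unfold sum_n; rewrite sum_Sn_m by apply Nat.le_0_l; now rewrite <- sum_n_m_S.
Qed.

(** Letting t tend to 0 kills the constant coefficient; dividing by t then lowers both the degree
    and the order of the bound by one. *)
Lemma poly_coef_eq_0 (N : nat) (D : nat -> C) (K d : R) : (0 < d)%R ->
  (forall t : R, (0 < t < d)%R ->
    (Cmod (sum_n (fun i => (D i * RtoC t ^ i)%C) N) <= K * t ^ S N)%R) ->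
  forall i : nat, (i <= N)%nat -> D i = 0.
Proof.
revert D; induction N as [|N IH]; intros D Hd H.
- intros i Hi; replace i with 0%nat by lia.
  apply (eq_0_of_Cmod_le_linear _ K d Hd); intros t Ht.
  assert (H1 := H t Ht); rewrite sum_O, pow_1 in H1; simpl in H1.
  now rewrite Cmult_1_r in H1.
- set (Q := fun t : R => sum_n (fun i => D (S i) * RtoC t ^ i) N).
  assert (HQ : forall t : R,
    sum_n (fun i => D i * RtoC t ^ i) (S N) = D 0%nat + t * Q t).
  { intros t; rewrite sum_n_shift; simpl Cpow; rewrite Cmult_1_r; f_equal.
    unfold Q; rewrite <- (sum_n_mult_l (K := C_Ring)); apply sum_n_ext; intros i.
    change (D (S i) * (t * RtoC t ^ i) = t * (D (S i) * RtoC t ^ i)); ring. }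
  (* A crude bound is enough: it makes t Q(t) of order t. *)
  assert (HB : forall t : R, (0 < t < 1)%R ->
    (Cmod (Q t) <= sum_n (fun i => Cmod (D (S i))) N)%R).
  { intros t Ht; unfold Q.
    assert (Hi : forall i, (Cmod (D (S i) * RtoC t ^ i) <= Cmod (D (S i)))%R).
    { intros i; rewrite Cmod_mult, Cmod_pow, Cmod_R, Rabs_pos_eq by lra.
      assert (H1 : (t ^ i <= 1)%R) by (rewrite <- (pow1 i); apply pow_incr; lra).
      assert (H2 := Cmod_ge_0 (D (S i))); nra. }
    generalize N; intros P; induction P as [|P IHP]; [rewrite !sum_O; apply Hi|].
    rewrite !sum_Sn; eapply Rle_trans; [apply Cmod_triangle|].
    now apply Rplus_le_compat. }
  assert (H0 : D 0%nat = 0).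
  { apply (eq_0_of_Cmod_le_linear _
      (Rabs K + sum_n (fun i => Cmod (D (S i))) N) (Rmin d 1)).
    - apply Rmin_glb_lt; lra.
    - intros t Ht.
      assert (Htd := Rmin_l d 1); assert (Ht1 := Rmin_r d 1).
      assert (H1 := H t ltac:(lra)); rewrite HQ in H1.
      assert (H2 := HB t ltac:(lra)).
      replace (D 0%nat) with ((D 0%nat + t * Q t) + - (t * Q t)) by ring.
      eapply Rle_trans; [apply Cmod_triangle|].
      rewrite Cmod_opp, Cmod_mult, Cmod_R, (Rabs_pos_eq t) by lra.
      assert (H3 : (t ^ S N <= 1)%R) by (rewrite <- (pow1 (S N)); apply pow_incr; lra).
      assert (H4 : (0 <= t ^ S N)%R) by (apply pow_le; lra).
      (* The sign of K is unknown, hence [Rabs K]; for t < 1 the power t^(N+2) is at most t. *)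
      assert (H5 : (K * t ^ S (S N) <= Rabs K * t)%R).
      { change (t ^ S (S N))%R with (t * t ^ S N)%R.
        assert (H6 := Rle_abs K); assert (H7 := Rabs_pos K).
        assert (H8 : (t * t ^ S N <= t)%R) by nra.
        assert (H9 : (0 <= t * t ^ S N)%R) by nra.
        nra. }
      nra. }
  intros [|i] Hi; [easy|].
  apply (IH (fun i => D (S i))); [easy| |lia].
  intros t Ht; change (Cmod (Q t) <= K * t ^ S N)%R.
  assert (H1 := H t Ht); rewrite HQ, H0, Cplus_0_l, Cmod_mult in H1.
  rewrite Cmod_R, Rabs_pos_eq in H1 by lra.
  (* With the constant coefficient gone, a factor t cancels on both sides. *)
  apply (Rmult_le_reg_l t); [lra|].
  replace (t * (K * t ^ S N))%R with (K * t ^ S (S N))%R by (simpl; ring).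
  easy.
Qed.

(** * Absolute summability of the weights *)

(** The moduli are |v| |r|^m and tend to 0: either |r| < 1 and the geometric series converges, or
    |r| >= 1 forces v = 0. *)
Lemma ex_series_Cmod_weight (beta : C) (a b : R) :
  ex_series (weight beta a b) -> ex_series (fun m => Cmod (weight beta a b m)).
Proof.
intros H; apply Cmod_lim_0_of_ex_series in H.
set (v := Cpower a (RtoC (- b))) in *.
set (r := Cpower beta b * v) in *.
assert (E : forall m, Cmod (weight beta a b m) = (Cmod v * Cmod r ^ m)%R).
{ intros m; rewrite weight_eq, <- Cmod_pow, <- Cmod_mult; f_equal.
  fold v; unfold r; rewrite Cpow_mult_l, Cpow_S; ring. }
apply (ex_series_ext (fun m => Cmod v * Cmod r ^ m)%R); [easy|].
destruct (Rlt_or_le (Cmod r) 1) as [Hr|Hr].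
- apply (ex_series_scal (K := R_AbsRing) (V := R_NormedModule)), ex_series_geom.
  rewrite Rabs_pos_eq; [easy|apply Cmod_ge_0].
- replace (Cmod v) with 0%R.
  + apply (ex_series_ext (fun m => 0 * 0 ^ m)%R).
    * intros m; now rewrite !Rmult_0_l.
    * apply (ex_series_scal (K := R_AbsRing) (V := R_NormedModule)), ex_series_geom.
      rewrite Rabs_R0; lra.
  (* Here |v| <= |v| |r|^m, which tends to 0. *)
  + apply Rle_antisym; [apply Cmod_ge_0|].
    apply (is_lim_seq_le (fun _ => Cmod v) _ (Cmod v) 0) in H; [easy| |apply is_lim_seq_const].
    intros m; rewrite E.
    assert (H1 := pow_R1_Rle (Cmod r) m Hr); assert (H0 := Cmod_ge_0 v); nra.
Qed.

(** * Combining the two expansions *)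

(** Multiplication by g t^k shifts indices by k; merging both sums into one polynomial lets
    [poly_coef_eq_0] apply. *)
Lemma sum_n_add_shifted (c e : nat -> C) (g t : C) (k J : nat) : (0 < k)%nat ->
  sum_n (fun i => (c i + (if (k <=? i)%nat then g * e (i - k)%nat else 0)) * t ^ i)
    (k + J) =
  sum_n (fun i => c i * t ^ i) (k + J) + g * t ^ k * sum_n (fun j => e j * t ^ j) J.
Proof.
intros hk; induction J as [|J IH].
- destruct k as [|k]; [lia|].
  rewrite Nat.add_0_r, !sum_Sn, sum_O, Nat.leb_refl, Nat.sub_diag.
  (* Below index [S k] the shifted part contributes nothing. *)
  rewrite (sum_n_ext_loc _ (fun i => c i * t ^ i) k).
  + change plus with Cplus; set (P := sum_n _ k).
    change (P + (c (S k) + g * e 0%nat) * t ^ S k =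
      P + c (S k) * t ^ S k + g * t ^ S k * (e 0%nat * 1)); ring.
  + intros i Hi; replace (S k <=? i)%nat with false
      by (symmetry; apply Nat.leb_gt; lia).
    change ((c i + 0) * t ^ i = c i * t ^ i); ring.
- rewrite Nat.add_succ_r, !sum_Sn, IH.
  replace (k <=? S (k + J))%nat with true by (symmetry; apply Nat.leb_le; lia).
  replace (S (k + J) - k)%nat with (S J) by lia.
  replace (t ^ S (k + J)) with (t ^ k * t ^ S J)
    by (rewrite <- Cpow_add_r; f_equal; lia).
  set (P := sum_n _ (k + J)); set (Q := sum_n _ J).
  change (P + g * t ^ k * Q + (c (S (k + J)) + g * e (S J)) * (t ^ k * t ^ S J) =
    P + c (S (k + J)) * (t ^ k * t ^ S J) + g * t ^ k * (Q + e (S J) * t ^ S J)).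
  ring.
Qed.

Theorem theorem8 (q : R) (hq : (Rabs q < 1)%R) (a b : R) (beta : C) (k : nat)
    (hk : (0 < k)%nat) (x : C) (S : nat -> C)
    (hS : is_unified_qGenocchi q beta a b k x S)
    (n : nat) (hkn : (k <= n)%nat) :
  ex_series (qHurwitz_term q beta a b (RtoC (- INR (n - k))) x) /\
  qHurwitz_zeta q beta a b k (RtoC (- INR (n - k))) x =
    (- (RtoC (INR (fact (n - k)) / INR (fact n)) * S n))%C.
Proof.
set (w := weight beta a b).
set (y := fun m : nat => qnum q (RtoC (INR m) + x)).
set (g := qtwo_factor q k).
destruct (Cmod_qnum_bounded q x hq) as [M HM]; fold (y) in HM.
assert (Hw : ex_series (fun m => Cmod (w m))).
{ apply ex_series_Cmod_weight.
  (* At t = 0 every exponential is 1, so the weights themselves form a convergent series. *)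
  destruct (locally_singleton _ _ hS) as [G [HG _]].
  exists G; eapply is_series_ext; [|apply HG].
  intros m; cbv beta; rewrite Cmult_0_r, Cexp_0; apply Cmult_1_r. }
assert (HA : forall j, is_series (fun m => w m * y m ^ j)
  (CSeries (fun m => w m * y m ^ j))).
{ intros j.
  assert (Hex : ex_series (fun m => w m * y m ^ j)).
  { apply (ex_series_le (K := C_AbsRing) (V := C_CompleteNormedModule) _
      (fun m => Cmod (w m) * M ^ j)%R).
    - intros m; change (Cmod (w m * y m ^ j) <= Cmod (w m) * M ^ j)%R.
      rewrite Cmod_mult, Cmod_pow.
      apply Rmult_le_compat_l; [apply Cmod_ge_0|].
      apply pow_incr; split; [apply Cmod_ge_0|apply HM].
    - destruct Hw as [W HW]; eexists; apply (is_series_scal_r _ _ _ HW). }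
  destruct Hex as [L HL]; now rewrite (CSeries_unique _ _ HL). }
set (A := fun j : nat => CSeries (fun m => w m * y m ^ j)) in HA.
assert (Hterm : forall j m,
  qHurwitz_term q beta a b (RtoC (- INR j)) x m = w m * y m ^ j).
{ intros j m; unfold qHurwitz_term, Cdiv; now rewrite inv_Cpower_opp_INR. }
(* At s = -(n-k) the zeta terms are those of [A (n - k)], so the zeta value is g A_(n-k). *)
assert (Hz : is_series (qHurwitz_term q beta a b (RtoC (- INR (n - k))) x) (A (n - k)%nat)).
{ eapply is_series_ext; [|apply HA]; intros m; symmetry; apply Hterm. }
split; [now exists (A (n - k)%nat)|].
unfold qHurwitz_zeta; rewrite (CSeries_unique _ _ Hz); fold g.
destruct hS as [d Hd].
assert (Hd' : forall t : R, (0 < t < d)%R -> exists G : C,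
  is_series (fun m => w m * Cexp (y m * t)) G /\
  is_series (fun i => S i / RtoC (INR (fact i)) * RtoC t ^ i) (- (g * t ^ k * G))).
{ intros t Ht; destruct (Hd (RtoC t)) as [G [HG HF]].
  - apply C_NormedModule_mixin_compat1.
    change (Cmod (RtoC t - RtoC 0)%C < d)%R.
    replace (t - 0)%C with (RtoC t) by ring; rewrite Cmod_R, Rabs_pos_eq; lra.
  - exists G; split; [exact HG|].
    eapply is_series_ext; [|apply HF].
    intros i; change (S i * (t ^ i / RtoC (INR (fact i))) =
      S i / RtoC (INR (fact i)) * t ^ i); unfold Cdiv; ring. }
assert (Hd0 := cond_pos d).
(* Degree n-k suffices, since the factor t^k raises the error to order n+1. *)
destruct (exp_series_taylor w y A M (n - k) HM Hw HA) as [K1 HK1].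
(* Convergence is known at [d / 2], inside the neighbourhood; the estimate then holds for t <=
   d/4. *)
destruct (power_series_taylor (fun i => S i / RtoC (INR (fact i))) (d / 2) n) as [K2 HK2].
{ lra. }
{ destruct (Hd' (d / 2)%R) as [G [_ HG]]; [lra|]; eexists; apply HG. }
set (c := fun i => S i / RtoC (INR (fact i))) in *.
set (e := fun j => A j / RtoC (INR (fact j))).
(* This is the coefficient of t^n in the sum of the power series of [S] and g t^k G, a sum that is
   identically 0. *)
assert (HD : c n + (if (k <=? n)%nat then g * e (n - k)%nat else 0) = 0).
{ refine (poly_coef_eq_0 n
    (fun i => c i + (if (k <=? i)%nat then g * e (i - k)%nat else 0))
    (K2 + Cmod g * K1) (Rmin 1 (d / 4)) _ _ n (le_n n)).
  { apply Rmin_glb_lt; lra. }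
  intros t Ht; assert (Ht1 := Rmin_l 1 (d / 4)); assert (Ht2 := Rmin_r 1 (d / 4)).
  destruct (Hd' t) as [G [HG HF]]; [lra|].
  apply HK1 in HG; [|lra]; apply HK2 in HF; [|lra].
  rewrite (sum_n_ext _ (fun j => e j * t ^ j)) in HG
    by (intros j; unfold e, Cdiv; change (A j * (t ^ j * / RtoC (INR (fact j))) =
          A j * / RtoC (INR (fact j)) * t ^ j); ring).
  replace n with (k + (n - k))%nat at 1 by lia.
  rewrite sum_n_add_shifted by easy.
  replace (k + (n - k))%nat with n by lia.
  set (P := sum_n _ n) in *; set (Q := sum_n _ (n - k)) in *.
  (* The power series sums to -g t^k G, so the combined polynomial consists only of the two
     remainders. *)
  replace (P + g * t ^ k * Q)
    with (- (- (g * t ^ k * G) - P) + - (g * t ^ k * (G - Q))) by ring.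
  eapply Rle_trans; [apply Cmod_triangle|].
  rewrite !Cmod_opp, Rmult_plus_distr_r; apply Rplus_le_compat; [exact HF|].
  rewrite !Cmod_mult, Cmod_pow, Cmod_R, Rabs_pos_eq by lra.
  replace (t ^ Datatypes.S n)%R with (t ^ k * t ^ Datatypes.S (n - k))%R
    by (rewrite <- pow_add; f_equal; lia).
  replace (Cmod g * K1 * (t ^ k * t ^ Datatypes.S (n - k)))%R
    with (Cmod g * t ^ k * (K1 * t ^ Datatypes.S (n - k)))%R by ring.
  apply Rmult_le_compat_l; [|exact HG].
  apply Rmult_le_pos; [apply Cmod_ge_0|apply pow_le; lra]. }
replace (k <=? n)%nat with true in HD by (symmetry; now apply Nat.leb_le).
unfold c, e in HD.
assert (Hn : RtoC (INR (fact n)) <> 0)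
  by (intros E; apply RtoC_inj in E; now apply (INR_fact_neq_0 n)).
assert (Hnk : RtoC (INR (fact (n - k))) <> 0)
  by (intros E; apply RtoC_inj in E; now apply (INR_fact_neq_0 (n - k))).
rewrite RtoC_div by apply INR_fact_neq_0.
(* The bracket is the left side of [HD], so only the term in [S n] survives. *)
replace (g * A (n - k)%nat) with
  (RtoC (INR (fact (n - k))) * (S n / RtoC (INR (fact n))
     + g * (A (n - k)%nat / RtoC (INR (fact (n - k)))))
   - RtoC (INR (fact (n - k))) / RtoC (INR (fact n)) * S n)
  by (field; now split).
rewrite HD; ring.
Qed.
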